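(* Let $(Z,\mathcal A)$ be a measurable space, $\mathcal F$ a convex set of bounded measurable functions from $Z$ to $\mathbb R$, $C:\mathcal F\times Z\to[0,\infty)$ a convex, line-continuous cost function, and $P$ a probability measure on $Z$. Assume that a minimizer $f_{P,\mathcal F}\in\mathcal F$ of $f\mapsto\mathcal R_{C,P}(f)$ exists and that for every $n\ge1$ and every $T\in Z^n$ a minimizer $f_{T,\mathcal F}\in\mathcal F$ of $f\mapsto\mathcal R_{C,T}(f)$ exists. Assume that $\mathcal G:=\{C\circ f-C\circ f_{P,\mathcal F}: f\in\mathcal F\}$ is separable with respect to $\|\cdot\|_\infty$, and that there are constants $b,B\ge0$, $\beta\in[0,1]$, $w,W\ge0$, $\nu\in[0,2]$, $\vartheta\in[0,2)$ such that for all $g\in\mathcal G$ $$\|g\|_\infty\le b(\mathbb E_Pg)^\beta+B\quad\text{and}\quad \mathbb E_Pg^2\le\big(b(\mathbb E_Pg)^\beta+B\big)^\nu\big(w(\mathbb E_Pg)^\vartheta+W\big).$$ Then for all $n\ge1$, $x\ge1$ and $\varepsilon>0$ satisfying $$\varepsilon\ge3\,\omega_{P,n}(\mathcal G,\varepsilon)+\sqrt{\frac{2x(b\varepsilon^\beta+B)^\nu(w\varepsilon^\vartheta+W)}{n}}+\frac{2x(b\varepsilon^\beta+B)}{n}$$ we have $$\Pr{}^*\big(T\in Z^n:\ \mathcal R_{C,P}(f_{T,\mathcal F})<\mathcal R_{C,P}(f_{P,\mathcal F})+\varepsilon\big)\ge1-e^{-x},$$ where $\Pr^*$ denotes outer probability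 with respect to $P^n$.
   Context: A cost function is a map $C:\mathcal F\times Z\to[0,\infty)$ such that $C\circ f:=C(f,\cdot)$ is measurable for every $f\in\mathcal F$; $\mathcal R_{C,P}(f):=\mathbb E_{z\sim P}C(f,z)$, and for $T=(z_1,\dots,z_n)$, $\mathcal R_{C,T}(f):=\frac1n\sum_iC(f,z_i)$. $C$ is convex if $C(\cdot,z)$ is convex on $\mathcal F$ for every $z$, and line-continuous if for all $z\in Z$ and $f,\hat f\in\mathcal F$ the map $t\mapsto C(tf+(1-t)\hat f,z)$ is continuous on $[0,1]$. For a class $\mathcal G$ of bounded measurable functions on $Z$ separable w.r.t. $\|\cdot\|_\infty$, the modulus of continuity is $\omega_{P,n}(\mathcal G,\varepsilon):=\mathbb E_{T\sim P^n}\sup\{|\mathbb E_Pg-\mathbb E_Tg|: g\in\mathcal G,\ \mathbb E_Pg\le\varepsilon\}$, where $\mathbb E_T g=\frac1n\sum_i g(z_i)$.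
   Formalization: The formal theorem adds the assumption that the minimal risk R_{C,P}(f_{P,F}) is finite; if it is infinite, every risk is infinite, the event in the conclusion is empty, and the claim fails. *)

(* Defs.v *)
From HB Require Import structures.
From mathcomp Require Import all_boot all_order all_algebra.
From mathcomp Require Import all_classical all_reals all_analysis.
Set Implicit Arguments. Unset Strict Implicit. Unset Printing Implicit Defensive.
Import Order.TTheory GRing.Theory Num.Theory.
Import numFieldNormedType.Exports.
Local Open Scope classical_set_scope.
Local Open Scope ring_scope.

Section defs.
Context {R : realType} {d : measure_display} {Z : measurableType d}.

Definition lincomb (t : R) (f g : Z -> R) : Z -> R :=
  fun z => t * f z + (1 - t) * g z.

Definition convex_fset (F : set (Z -> R)) : Prop :=
  forall f g t, F f -> F g -> 0 <= t <= 1 -> F (lincomb t f g).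


Definition cost_function (F : set (Z -> R)) (C : (Z -> R) -> Z -> R) : Prop :=
  forall f, F f -> (forall z, 0 <= C f z) /\ measurable_fun setT (C f).

Definition convex_cost (F : set (Z -> R)) (C : (Z -> R) -> Z -> R) : Prop :=
  forall z f g t, F f -> F g -> 0 <= t <= 1 ->
    C (lincomb t f g) z <= t * C f z + (1 - t) * C g z.

Definition line_continuous (F : set (Z -> R)) (C : (Z -> R) -> Z -> R) : Prop :=
  forall z f fh, F f -> F fh ->
    {within `[0%R, 1%R], continuous (fun t : R => C (lincomb t f fh) z)}.

Definition risk (P : probability Z R) (C : (Z -> R) -> Z -> R) (f : Z -> R) : \bar R :=
  (\int[P]_z (C f z)%:E)%E.

Definition emp_mean (n : nat) (T : n.-tuple Z) (g : Z -> R) : R :=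
  n%:R^-1 * \sum_(i < n) g (tnth T i).

Definition emp_risk (C : (Z -> R) -> Z -> R) (n : nat) (T : n.-tuple Z) (f : Z -> R) : R :=
  emp_mean T (C f).

Definition expect (P : probability Z R) (g : Z -> R) : R := Rintegral P setT g.

Definition sup_separable (G : set (Z -> R)) : Prop :=
  exists D : set (Z -> R), countable D /\ D `<=` G /\
    forall g, G g -> forall e : R, 0 < e -> exists2 h, D h & forall z, `|g z - h z| < e.

(** Q is the n-fold product probability P^n on Z^n (n.-tuple Z with its
    product sigma-algebra): product rule on measurable rectangles; this
    determines Q uniquely (pi-lambda theorem). *)
Definition is_product_prob (P : probability Z R) (n : nat)
    (Q : probability (n.-tuple Z) R) : Prop :=
  forall A : 'I_n -> set Z, (forall i, measurable (A i)) ->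
    Q [set T | forall i, A i (tnth T i)] = (\prod_(i < n) P (A i))%E.

Definition outer_prob (n : nat) (Q : probability (n.-tuple Z) R) (E : set (n.-tuple Z)) : \bar R :=
  ereal_inf [set Q A | A in [set A | measurable A /\ E `<=` A]].

Definition modulus (P : probability Z R) (n : nat) (Q : probability (n.-tuple Z) R)
    (G : set (Z -> R)) (eps : R) : \bar R :=
  (\int[Q]_T ereal_sup [set (`|expect P g - emp_mean T g|)%:E
                         | g in [set g | G g /\ (expect P g <= eps)%R]])%E.

End defs.

(* Main.v *)
(** Convexity turns a large risk of the empirical minimizer [f_T] into an
    event about a supremum: if [f_T] has excess risk at least [eps], then by
    line-continuity some [f] on the segment from [f_P] to [f_T] has excess risk
    exactly [eps], while by convexity its empirical excess risk is at most [0].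
    Hence [E_P g - E_T g >= eps] for some [g] in [G] with [E_P g = eps], and the
    claim follows from a Talagrand-type inequality
      [Pr (S >= 3 E S + sqrt (2 x n sigma^2) + U x) <= exp (- x)]
    for the supremum [S] of the centred empirical sums bounded above by [U].

    That inequality is proved by Bousquet's entropy method on a finite product
    space. With [V = S - S_k] the effect of the [k]-th observation and [y <= V]
    the value at this observation of the maximizer of [S_k], the entropy of
    [exp (l S)] tensorizes into terms controlled through
      [(1 + l) (t e^t - e^t + 1) <= l t (e^t - 1) + t^2 / 2], [t = l V <= l],
    and Herbst's argument integrates the resulting differential inequality into
      [ln E exp (l S) <= l (e^l E S + (e^l - 1) n sigma^2 / 2)].

    The general case reduces to the finite one by rounding finitely many
    functions to a grid of mesh [delta]: product cells have product
    probability, so no integration over [Z^n] beyond simple functions occurs.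
    The rounding error is absorbed by replacing [x] with a smaller [x'], and
    letting [x'] tend to [x] at the end. *)
Require Import Defs.
From HB Require Import structures.
From mathcomp Require Import all_boot all_order all_algebra.
From mathcomp Require Import all_classical all_reals all_analysis.
From mathcomp Require Import measurable_realfun.
From mathcomp Require Import ring lra.
Import Order.TTheory GRing.Theory Num.Theory.
Import numFieldNormedType.Exports.
Local Open Scope classical_set_scope.
Local Open Scope ring_scope.
Set Implicit Arguments.
Unset Strict Implicit.

(** * Inequalities for the exponential *)

Section real_inequalities.
Context {R : realType}.
Implicit Types (f df : R -> R) (t l x : R).

Lemma nonneg_derive_nondecreasing f df (a b : R) :
  (forall t, a <= t <= b -> is_derive t 1 f (df t)) ->
  (forall t, a < t < b -> 0 <= df t) -> a <= b -> f a <= f b.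
Proof.
move=> fdf df0 ab.
have dfab t : t \in `]a, b[ -> is_derive t 1 f (df t).
  by rewrite in_itv/= => /andP[at_ tb]; apply: fdf; rewrite !ltW.
apply: (@ger0_derive1_le_cc _ f a b); rewrite ?bound_itvE//.
- by move=> t /dfab [].
- move=> t tab; rewrite derive1E (@derive_val _ _ _ _ _ _ _ (dfab _ tab)).
  by apply: df0; move: tab; rewrite in_itv.
- apply: derivable_within_continuous => t.
  by rewrite in_itv/= => /fdf [].
Qed.

Lemma expR_ge_quadratic t : 0 <= t -> 1 + t + t ^+ 2 / 2 <= expR t.
Proof.
move=> t0.
suff : expR 0 - (1 + 0 + 0 ^+ 2 / 2) <= expR t - (1 + t + t ^+ 2 / 2) :> R.
  by rewrite expR0; lra.
apply: (@nonneg_derive_nondecreasing (fun t => expR t - (1 + t + t ^+ 2 / 2))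
  (fun t => expR t - (1 + t))) => // s _.
- apply: is_derive_eq.
  by rewrite /GRing.scale /=; lra.
- by rewrite subr_ge0 expR_ge1Dx.
Qed.

Lemma mulexpR_le_quadratic t : t <= 0 ->
  t * expR t - expR t + 1 <= t ^+ 2 / 2.
Proof.
move=> t0.
suff : t * expR t - expR t - t ^+ 2 / 2 <= 0 * expR 0 - expR 0 - 0 ^+ 2 / 2 :> R.
  by rewrite expR0; lra.
apply: (@nonneg_derive_nondecreasing
  (fun t => t * expR t - expR t - t ^+ 2 / 2)
  (fun t => t * (expR t - 1))) => // s.
- move=> _; apply: is_derive_eq.
  by rewrite /GRing.scale /=; lra.
- by case/andP=> _ s0; rewrite mulr_le0 ?(ltW s0)// subr_le0 expR_le1 ltW.
Qed.

(** The quotient [k] of the two sides has derivative [s (1 - s) e^(-s)], negative for [s < 0] and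
    nonnegative on [[0, 1]], so its minimum over [s <= 1] is [k 0 = 1]. *)
Lemma expR_le_quadratic t : t <= 1 -> expR t <= 1 + t + t ^+ 2.
Proof.
move=> t1.
pose k (s : R) := (1 + s + s ^+ 2) * expR (- s).
pose dk (s : R) := s * (1 - s) * expR (- s).
have kdk (s : R) : is_derive s 1 k (dk s).
  by rewrite /k; apply: is_derive_eq; rewrite /dk /GRing.scale /=; lra.
suff : 1 <= k t.
  by rewrite /k expRN ler_pdivlMr ?mul1r ?expR_gt0.
have -> : 1 = k 0 by rewrite /k oppr0 expR0; lra.
have [t0|t0] := leP 0 t.
  apply: (@nonneg_derive_nondecreasing k dk) => // s /andP[s0 st].
  by rewrite !mulr_ge0 ?expR_ge0//; lra.
rewrite -lerN2.
apply: (@nonneg_derive_nondecreasing (fun s => - k s) (fun s => - dk s)).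
- move=> s /andP[st s0]; rewrite oppr_ge0 /dk pmulr_lle0 ?expR_gt0//.
  by rewrite pmulr_lle0; lra.
- exact: ltW.
Qed.

(** The difference of the sides is affine in [l] with slope [e^t - 1 - t >= 0]. For [t >= 0] the
    worst case is [l = t], where [expR_ge_quadratic] applies; for [t < 0] it is [l = 0], where
    [mulexpR_le_quadratic] does. *)
Lemma expR_entropy_bound l t : 0 <= l -> t <= l ->
  (1 + l) * (t * expR t - expR t + 1) <= l * t * (expR t - 1) + t ^+ 2 / 2.
Proof.
move=> l0 tl; rewrite -subr_ge0.
have -> : l * t * (expR t - 1) + t ^+ 2 / 2 -
    (1 + l) * (t * expR t - expR t + 1) =
    l * (expR t - (1 + t)) + (t ^+ 2 / 2 - (t * expR t - expR t + 1)) by lra.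
have e1 : 0 <= expR t - (1 + t) by rewrite subr_ge0 expR_ge1Dx.
have [t0|t0] := leP 0 t.
  have := expR_ge_quadratic t0; have := ler_wpM2r e1 tl; lra.
have := mulexpR_le_quadratic (ltW t0); have := mulr_ge0 l0 e1; lra.
Qed.

End real_inequalities.

(** * Entropy on finite product spaces *)

Section product_expectation.
Context {R : realType} {Om : finType} (p : Om -> R) (n : nat).
Implicit Types (F f g : {ffun 'I_n -> Om} -> R).
Implicit Types (w : {ffun 'I_n -> Om}) (k : 'I_n).

Definition weight w : R := \prod_i p (w i).

Definition Ex F : R := \sum_w weight w * F w.

Definition upd w k (a : Om) : {ffun 'I_n -> Om} :=
  [ffun i => if i == k then a else w i].

Definition avg k F w : R := \sum_a p a * F (upd w k a).

Definition indep_of k F := forall w a, F (upd w k a) = F w.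

Hypothesis p0 : forall a, 0 <= p a.
Hypothesis p1 : \sum_a p a = 1.

Lemma upd_same w k a : upd w k a k = a.
Proof. by rewrite ffunE eqxx. Qed.

Lemma upd_other w k a i : i != k -> upd w k a i = w i.
Proof. by rewrite ffunE => /negbTE ->. Qed.

Lemma updupd w k a b : upd (upd w k a) k b = upd w k b.
Proof. by apply/ffunP => i; rewrite !ffunE; case: eqP. Qed.

Lemma upd_id w k : upd w k (w k) = w.
Proof. by apply/ffunP => i; rewrite !ffunE; case: eqP => // ->. Qed.

Lemma weight_upd w k a : weight w * p a = weight (upd w k a) * p (w k).
Proof.
rewrite /weight (bigD1 k)//= [in RHS](bigD1 k)//= upd_same.
rewrite [in RHS](eq_bigr (fun i => p (w i))).
  by rewrite mulrAC [p (w k) * p a]mulrC mulrAC.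
by move=> i ik; rewrite upd_other.
Qed.

Lemma weight_ge0 w : 0 <= weight w.
Proof. by apply: prodr_ge0 => i _. Qed.

Lemma sum_weight : \sum_w weight w = 1.
Proof.
rewrite /weight -(bigA_distr_bigA (fun (i : 'I_n) a => p a))/=.
by rewrite big1// => i _.
Qed.

Lemma ExD F g : Ex (fun w => F w + g w) = Ex F + Ex g.
Proof. by rewrite /Ex -big_split; apply: eq_bigr => w _; rewrite mulrDr. Qed.

Lemma ExZ c F : Ex (fun w => c * F w) = c * Ex F.
Proof. by rewrite /Ex mulr_sumr; apply: eq_bigr => w _; rewrite mulrCA. Qed.

Lemma ExB F g : Ex (fun w => F w - g w) = Ex F - Ex g.
Proof. by rewrite /Ex -sumrB; apply: eq_bigr => w _; rewrite mulrBr. Qed.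

Lemma Ex_sum (I : finType) (F : I -> {ffun 'I_n -> Om} -> R) :
  Ex (fun w => \sum_i F i w) = \sum_i Ex (F i).
Proof.
by rewrite /Ex exchange_big; apply: eq_bigr => w _; rewrite mulr_sumr.
Qed.

Lemma Ex_cst c : Ex (fun=> c) = c.
Proof. by rewrite /Ex -mulr_suml sum_weight mul1r. Qed.

Lemma le_Ex F g : (forall w, F w <= g w) -> Ex F <= Ex g.
Proof.
by move=> Fg; apply: ler_sum => w _; apply: ler_wpM2l => //; exact: weight_ge0.
Qed.

Lemma eq_Ex F g : (forall w, F w = g w) -> Ex F = Ex g.
Proof. by move=> Fg; apply: eq_bigr => w _; rewrite Fg. Qed.

Lemma Ex_gt0 F : (forall w, 0 < F w) -> 0 < Ex F.
Proof.
move=> F0; rewrite lt_neqAle; apply/andP; split; last first.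
  by rewrite -(Ex_cst 0); apply: le_Ex => w; exact: ltW.
apply/eqP => /esym Ex0.
have wF0 w : weight w * F w = 0.
  apply/eqP; rewrite eq_le mulr_ge0 ?weight_ge0 ?(ltW (F0 _))// andbT -Ex0.
  rewrite /Ex (bigD1 w)//= lerDl sumr_ge0// => v _.
  by rewrite mulr_ge0 ?weight_ge0 ?(ltW (F0 _)).
have := sum_weight; rewrite big1 => [/esym/eqP|w _]; first by rewrite oner_eq0.
by have /eqP := wF0 w; rewrite mulf_eq0 [F w == 0]gt_eqF ?orbF// => /eqP.
Qed.

(* [(w, a) |-> (upd w k a, w k)] is an involution preserving the weight *)
Lemma Ex_avg k F : Ex (avg k F) = Ex F.
Proof.
rewrite /Ex /avg.
under eq_bigr do rewrite mulr_sumr.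
rewrite pair_bigA/=.
pose s (q : {ffun 'I_n -> Om} * Om) := (upd q.1 k q.2, q.1 k).
have sK : involutive s.
  by case=> w a; rewrite /s/= upd_same updupd upd_id.
rewrite (reindex_inj (inv_inj sK))/=.
rewrite (eq_bigr (fun q => weight q.1 * F q.1 * p q.2)); last first.
  move=> [w a] _ /=; rewrite updupd upd_id mulrA.
  by rewrite -weight_upd mulrAC.
rewrite -(pair_bigA _ (fun w a => weight w * F w * p a))/=.
by apply: eq_bigr => w _; rewrite -mulr_sumr p1 mulr1.
Qed.

Lemma avgMl k F g w : indep_of k g ->
  avg k (fun w => g w * F w) w = g w * avg k F w.
Proof.
by move=> gk; rewrite /avg mulr_sumr; apply: eq_bigr => a _; rewrite gk mulrCA.
Qed.

Lemma indep_avg k F : indep_of k (avg k F).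
Proof. by move=> w a; apply: eq_bigr => b _; rewrite updupd. Qed.

Lemma avg_gt0 k F w : (forall w, 0 < F w) -> 0 < avg k F w.
Proof.
move=> F0; rewrite lt_neqAle; apply/andP; split; last first.
  by apply: sumr_ge0 => a _; rewrite mulr_ge0// ltW.
apply/eqP => /esym A0.
have pF0 a : p a * F (upd w k a) = 0.
  apply/eqP; rewrite eq_le mulr_ge0 ?(ltW (F0 _))// andbT -A0.
  rewrite /avg (bigD1 a)//= lerDl sumr_ge0// => b _.
  by rewrite mulr_ge0 ?(ltW (F0 _)).
have := p1; rewrite big1 => [/esym/eqP|a _]; first by rewrite oner_eq0.
by have /eqP := pF0 a; rewrite mulf_eq0 [F _ == 0]gt_eqF ?orbF// => /eqP.
Qed.

(* conditional expectation given the coordinates [i < n - j] *)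
Fixpoint cond (f : {ffun 'I_n -> Om} -> R) (j : nat) : {ffun 'I_n -> Om} -> R :=
  if j is j'.+1 then
    if insub (n - j)%N is Some k then avg k (cond f j') else cond f j'
  else f.

Lemma cond_gt0 f j w : (forall w, 0 < f w) -> 0 < cond f j w.
Proof.
move=> f0; elim: j w => [|j IH] w //=.
by case: insubP => [k _ _|_]; [exact: avg_gt0|exact: IH].
Qed.

Lemma Ex_cond f j : Ex (cond f j) = Ex f.
Proof.
elim: j => [//|j IH] /=.
by case: insubP => [k _ _|_]; rewrite ?Ex_avg.
Qed.

Lemma cond_depends f j w w' : (j <= n)%N ->
  (forall i : 'I_n, (i < n - j)%N -> w i = w' i) -> cond f j w = cond f j w'.
Proof.
elim: j w w' => [|j IH] w w' jn ww'.
  by congr f; apply/ffunP => i; apply: ww'; rewrite subn0.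
rewrite /=; case: insubP => [k _ kE|]; last first.
  by rewrite ltn_subrL (leq_ltn_trans _ jn).
apply: eq_bigr => a _; congr (_ * _); apply: IH; first exact: ltnW.
move=> i ij; rewrite !ffunE; case: eqP => // /eqP ik.
apply: ww'; rewrite ltn_neqAle -{1}kE ik/=.
by rewrite -ltnS -subSn.
Qed.

(** No coordinate is left to depend on, so [cond f n] is constant and equals its own mean. *)
Lemma cond_n f w : cond f n w = Ex f.
Proof.
rewrite -(Ex_cond f n) -{1}(Ex_cst (cond f n w)); apply: eq_Ex => w'.
by apply: cond_depends => // i; rewrite subnn.
Qed.

(** The Bregman divergence of [u ln u]; for positive random [a], its mean minimized over constants
    [b] is the entropy of [a]. *)
Definition kl_term (a b : R) := a * ln (a / b) - a + b.

(** With [c], [d] the two conditional expectations, [ln y <= y - 1] at [y = c g / (d f)] bounds the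
    left integrand by [kl_term f g + g (c / d - 1)]. The last term has mean [0], since [g] and [d]
    ignore coordinate [k] and averaging [c] over it gives [d]. *)
Lemma Ex_cond_step f g k j : (forall w, 0 < f w) -> (forall w, 0 < g w) ->
  indep_of k g -> (n - j.+1)%N = k ->
  Ex (fun w => f w * (ln (cond f j w) - ln (cond f j.+1 w))) <=
  Ex (fun w => kl_term (f w) (g w)).
Proof.
move=> f0 g0 gk jk.
have fS : cond f j.+1 = avg k (cond f j).
  by rewrite /= jk valK.
pose r w := g w * (cond f j w / cond f j.+1 w - 1).
have Er0 : Ex r = 0.
  rewrite -(Ex_avg k) -(Ex_cst 0); apply: eq_Ex => w.
  rewrite /r avgMl//.
  have -> : avg k (fun w => cond f j w / cond f j.+1 w - 1) w =
      avg k (cond f j) w / cond f j.+1 w - 1.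
    rewrite /avg -[X in _ - X]p1 mulr_suml -sumrB; apply: eq_bigr => a _.
    by rewrite fS indep_avg mulrBr mulr1 mulrA.
  by rewrite -fS divff ?subrr ?mulr0// gt_eqF// cond_gt0.
rewrite -subr_le0 -ExB -Er0; apply: le_Ex => w.
rewrite /r /kl_term.
have a0 := f0 w; have b0 := g0 w.
have c0 := cond_gt0 j w f0; have d0 := cond_gt0 j.+1 w f0.
move: (cond f j w) (cond f j.+1 w) (f w) (g w) c0 d0 a0 b0 => c d a b c0 d0 a0 b0.
have : ln (c * b / (d * a)) <= c * b / (d * a) - 1.
  rewrite -[X in ln X](subrKC 1) le_ln1Dx//.
  by rewrite ltrBrDl subrr !(mulr_gt0,invr_gt0).
rewrite !(lnM,lnV) ?posrE ?(mulr_gt0,invr_gt0)// => /(ler_wpM2l (ltW a0)).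
have -> : a * (c * b / (d * a) - 1) = b * (c / d) - a.
  by field; rewrite !gt_eqF.
lra.
Qed.

(** Chain rule: [ln f - ln (Ex f)] telescopes along [cond], and [Ex_cond_step] bounds each increment
    with a comparison function [g k] of free choice. *)
Lemma entropy_tensorization f (g : 'I_n -> {ffun 'I_n -> Om} -> R) :
  (forall w, 0 < f w) -> (forall k w, 0 < g k w) ->
  (forall k, indep_of k (g k)) ->
  Ex (fun w => f w * ln (f w)) - Ex f * ln (Ex f) <=
  \sum_k Ex (fun w => kl_term (f w) (g k w)).
Proof.
move=> f0 g0 gk.
have tel m : (m <= n)%N ->
    Ex (fun w => f w * (ln (f w) - ln (cond f m w))) =
    \sum_(j < m) Ex (fun w => f w * (ln (cond f j w) - ln (cond f j.+1 w))).
  elim: m => [_|m IH mn].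
    by rewrite big_ord0 -(Ex_cst 0); apply: eq_Ex => w; rewrite /= subrr mulr0.
  rewrite big_ord_recr/= -IH ?(ltnW mn)// -ExD; apply: eq_Ex => w /=; lra.
have -> : Ex (fun w => f w * ln (f w)) - Ex f * ln (Ex f) =
    Ex (fun w => f w * (ln (f w) - ln (cond f n w))).
  rewrite mulrC -ExZ -ExB; apply: eq_Ex => w; rewrite cond_n; lra.
(* Step [j] integrates out coordinate [n - j - 1], so reversing the sum indexes it by
   coordinates. *)
rewrite tel// (reindex_inj rev_ord_inj)/=; apply: ler_sum => k _.
apply: Ex_cond_step => //=; last by rewrite subnSK// subKn// ltnW.
Qed.

End product_expectation.

(** * The entropy of suprema of sums *)

Section supremum_process.
Context {R : realType} {Om J : finType} (p : Om -> R) (n : nat) (j0 : J).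
Context (h : J -> Om -> R) (s2 : R).
Hypothesis p0 : forall a, 0 <= p a.
Hypothesis p1 : \sum_a p a = 1.
Hypothesis h_le1 : forall j a, h j a <= 1.
Hypothesis Eh : forall j, \sum_a p a * h j a = 0.
Hypothesis Eh2 : forall j, \sum_a p a * h j a ^+ 2 <= s2.
Implicit Types (w : {ffun 'I_n -> Om}) (k : 'I_n).

Local Notation Ex := (@Ex R Om p n).

Definition argmaxf (F : J -> R) : J := [arg max_(j > j0) F j]%O.

Lemma le_argmaxf (F : J -> R) j : F j <= F (argmaxf F).
Proof. by rewrite /argmaxf; case: arg_maxP => // i _; exact. Qed.

Definition hsum w j := \sum_i h j (w i).
Definition supsum w := hsum w (argmaxf (hsum w)).
Definition hsum_but k w j := \sum_(i | i != k) h j (w i).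
(** This maximizer ignores coordinate [k], so [h (best_but k w) (w k)] is centred given the other
    coordinates, unlike the value at the maximizer of the full sum. *)
Definition best_but k w := argmaxf (hsum_but k w).
Definition supsum_but k w := hsum_but k w (best_but k w).

Lemma hsum_split k w j : hsum w j = h j (w k) + hsum_but k w j.
Proof. by rewrite /hsum (bigD1 k). Qed.

Lemma hsum_but_upd k w a : hsum_but k (upd w k a) = hsum_but k w.
Proof. by apply/funext => j; apply: eq_bigr => i ik; rewrite upd_other. Qed.

Lemma best_but_le k w :
  h (best_but k w) (w k) <= supsum w - supsum_but k w.
Proof.
by rewrite lerBrDr -hsum_split; exact: le_argmaxf.
Qed.

Lemma supsum_diff_le k w :
  supsum w - supsum_but k w <= h (argmaxf (hsum w)) (w k).
Proof.
by rewrite lerBlDr {1}/supsum (hsum_split k) lerD2l; exact: le_argmaxf.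
Qed.

(** Self-bounding property: each increment is at most the contribution [h j (w k)] of the maximizer
    [j] of the full sum, and these contributions add up to [supsum w]. *)
Lemma sum_supsum_diff_le w : \sum_k (supsum w - supsum_but k w) <= supsum w.
Proof. by apply: ler_sum => k _; exact: supsum_diff_le. Qed.

Lemma indep_supsum_but k : indep_of k (supsum_but k).
Proof.
by move=> w a; rewrite /supsum_but /best_but hsum_but_upd.
Qed.

Lemma avg_best_but k w (F : R -> R) :
  avg p k (fun w => F (h (best_but k w) (w k))) w =
  \sum_a p a * F (h (best_but k w) a).
Proof.
by apply: eq_bigr => a _; rewrite upd_same /best_but hsum_but_upd.
Qed.

(** With [V] the increment, [e^(l V) >= 1 + l V >= 1 + l y] for [y = h (best_but k w) (w k)], and
    [y] averages to [0] over coordinate [k]. *)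
Lemma expR_supsum_but_le l k w : 0 <= l ->
  expR (l * supsum_but k w) <= avg p k (fun w => expR (l * supsum w)) w.
Proof.
move=> l0.
apply: (@le_trans _ _ (avg p k (fun w => expR (l * supsum_but k w) *
   (1 + l * h (best_but k w) (w k))) w)); last first.
  apply: ler_sum => a _; apply: ler_wpM2l => //.
  have -> : supsum (upd w k a) = supsum_but k (upd w k a) +
      (supsum (upd w k a) - supsum_but k (upd w k a)) by rewrite addrC subrK.
  rewrite [in leRHS]mulrDr expRD ler_wpM2l ?expR_ge0//.
  rewrite (le_trans (expR_ge1Dx _))// ler_expR ler_wpM2l//.
  exact: best_but_le.
rewrite avgMl; last by move=> v a; rewrite indep_supsum_but.
rewrite (avg_best_but k w (fun y => 1 + l * y)).
rewrite (eq_bigr (fun a => p a + l * (p a * h (best_but k w) a))).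
  by rewrite big_split/= p1 -mulr_sumr Eh mulr0 addr0 mulr1.
by move=> a _; rewrite mulrDr mulr1 mulrCA.
Qed.

(** This is [expR_entropy_bound] at [t = l V], multiplied by [expR (l * supsum_but k w)]. The term
    in [V] is kept for [sum_supsum_diff_le]; the remainder [V^2 / 2 - V] is traded for one in [y],
    whose conditional mean is at most [s2 / 2]. *)
Lemma kl_term_supsum_le l k w : 0 <= l ->
  (1 + l) * kl_term (expR (l * supsum w)) (expR (l * supsum_but k w)) <=
  l ^+ 2 * ((supsum w - supsum_but k w) * expR (l * supsum w) +
    expR (l * supsum_but k w) *
      (h (best_but k w) (w k) ^+ 2 / 2 - h (best_but k w) (w k))).
Proof.
move=> l0.
have := best_but_le k w; have := supsum_diff_le k w.
have := h_le1 (argmaxf (hsum w)) (w k).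
move: (h (argmaxf (hsum w)) (w k)) => z.
move: (h (best_but k w) (w k)) => y z1.
rewrite /kl_term -expRB expRK -mulrBr.
have SE : l * supsum w = l * supsum_but k w + l * (supsum w - supsum_but k w).
  by rewrite -mulrDr subrKC.
rewrite SE expRD {SE}.
move: (supsum w - supsum_but k w) => V Vz yV.
have V1 : V <= 1 by lra.
have E0 : 0 < expR (l * supsum_but k w) by exact: expR_gt0.
move: (expR (l * supsum_but k w)) E0 => E E0.
have key := @expR_entropy_bound R l (l * V) l0 (ler_piMr l0 V1).
move: (expR (l * V)) key => e key.
have -> : (1 + l) * (E * e * (l * V) - E * e + E) =
    E * ((1 + l) * (l * V * e - e + 1)) by lra.
have -> : l ^+ 2 * (V * (E * e) + E * (y ^+ 2 / 2 - y)) =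
    E * (l ^+ 2 * (V * e + (y ^+ 2 / 2 - y))) by lra.
apply: ler_wpM2l; first exact: ltW.
apply: (le_trans key).
have -> : l * (l * V) * (e - 1) + (l * V) ^+ 2 / 2 =
    l ^+ 2 * (V * e + (V ^+ 2 / 2 - V)) by lra.
apply: ler_wpM2l; first exact: sqr_ge0.
(* [y ^+ 2 / 2 - y] decreases for [y <= 1], so [y = V] is the worst case *)
rewrite lerD2l -subr_ge0.
have -> : y ^+ 2 / 2 - y - (V ^+ 2 / 2 - V) = (V - y) * (2 - V - y) / 2 by lra.
by rewrite divr_ge0// mulr_ge0//; lra.
Qed.

Let M l := Ex (fun w => expR (l * supsum w)).
Let M1 l := Ex (fun w => supsum w * expR (l * supsum w)).

Lemma s2_ge0 : 0 <= s2.
Proof.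
by apply: le_trans (Eh2 j0); apply: sumr_ge0 => a _; rewrite mulr_ge0// sqr_ge0.
Qed.

(** The differential inequality for the moment generating function [M], whose derivative is [M1]:
    the entropy is tensorized with the comparison functions [expR (l * supsum_but k w)]. *)
Lemma supsum_entropy_le l : 0 <= l ->
  (1 + l) * (l * M1 l - M l * ln (M l)) <=
  l ^+ 2 * (M1 l + n%:R * s2 / 2 * M l).
Proof.
move=> l0.
have -> : l * M1 l - M l * ln (M l) =
    Ex (fun w => expR (l * supsum w) * ln (expR (l * supsum w))) - M l * ln (M l).
  by rewrite /M1 -ExZ; congr (_ - _); apply: eq_Ex => w; rewrite expRK; lra.
have l1 : 0 <= 1 + l by lra.
apply: (le_trans (ler_wpM2l l1 (@entropy_tensorization R Om p n p0 p1 _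
  (fun k w => expR (l * supsum_but k w)) _ _ _))).
- by move=> w; exact: expR_gt0.
- by move=> k w; exact: expR_gt0.
- by move=> k w a; rewrite indep_supsum_but.
pose D k w := supsum w - supsum_but k w.
have step k : (1 + l) * Ex (fun w => kl_term (expR (l * supsum w))
      (expR (l * supsum_but k w))) <=
    l ^+ 2 * (Ex (fun w => D k w * expR (l * supsum w)) + s2 / 2 * M l).
  rewrite -ExZ.
  apply: (le_trans (le_Ex p0 (fun w => kl_term_supsum_le k w l0))).
  rewrite ExZ ler_wpM2l ?sqr_ge0// ExD lerD2l.
  (* Averaging over coordinate [k] first freezes [supsum_but k w] and leaves only the mean and the
     second moment of [y]. *)
  rewrite -(Ex_avg p1 k) /M -(Ex_avg p1 k (fun w => expR _)) -ExZ.
  apply: le_Ex => // w.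
  rewrite avgMl; last by move=> v a; rewrite indep_supsum_but.
  apply: (@le_trans _ _ (expR (l * supsum_but k w) * (s2 / 2))); last first.
    by rewrite mulrC ler_wpM2l ?divr_ge0 ?s2_ge0// expR_supsum_but_le.
  apply: ler_wpM2l; first exact: expR_ge0.
  rewrite (avg_best_but k w (fun y => y ^+ 2 / 2 - y)).
  rewrite (eq_bigr (fun a => p a * h (best_but k w) a ^+ 2 / 2
     - p a * h (best_but k w) a)); last by move=> a _; rewrite mulrBr mulrA.
  by rewrite sumrB Eh subr0 -mulr_suml ler_wpM2r.
rewrite mulr_sumr; apply: (le_trans (ler_sum _ (fun k _ => step k))).
rewrite -mulr_sumr ler_wpM2l ?sqr_ge0// big_split/= sumr_const card_ord.
apply: lerD; last by rewrite -!mulrA mulr_natl.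
rewrite -Ex_sum; apply: le_Ex => // w; rewrite -mulr_suml.
by rewrite ler_wpM2r ?expR_ge0//; exact: sum_supsum_diff_le.
Qed.

Lemma Ex_supsum_ge0 : 0 <= Ex supsum.
Proof.
have <- : Ex (fun w => hsum w j0) = 0.
  rewrite Ex_sum big1// => k _.
  rewrite -(Ex_avg p1 k) -(@Ex_cst _ _ p n p1 0); apply: eq_Ex => w.
  by rewrite -(Eh j0); apply: eq_bigr => a _; rewrite upd_same.
by apply: le_Ex => // w; exact: le_argmaxf.
Qed.

End supremum_process.

(** * Concentration of suprema of sums *)

Section herbst.
Context {R : realType}.

(* the differential inequality says that [(psi l / l + c) * expR (- l)] is
   nonincreasing in [l] *)
Lemma herbst (psi dpsi : R -> R) (c e A r : R) :
  0 <= c -> 0 <= e -> 0 <= A -> 0 < r ->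
  (forall l : R, 0 < l -> is_derive l 1 psi (dpsi l)) ->
  (forall l : R, 0 < l ->
    (1 + l) * (l * dpsi l - psi l) <= l ^+ 2 * (dpsi l + c)) ->
  (forall l : R, 0 < l <= r -> psi l <= l * e + l ^+ 2 * A) ->
  forall l : R, 0 < l -> psi l <= l * (expR l * e + (expR l - 1) * c).
Proof.
move=> c0 e0 A0 r0 dpsiP ineq init l l0.
pose G (t : R) := - ((psi t * t^-1 + c) * expR (- t)).
pose dG (t : R) :=
  - (((t * dpsi t - psi t) / t ^+ 2 - (psi t * t^-1 + c)) * expR (- t)).
have dGP (t : R) : 0 < t -> is_derive t 1 G (dG t).
  move=> t0; have t0' : t != 0 by rewrite gt_eqF.
  have dp := dpsiP t t0.
  have dV : is_derive t 1 (fun x : R => x^-1) (- t ^- 2 *: 1).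
    exact: (@is_deriveV _ id).
  rewrite /G; apply: is_derive_eq.
  by rewrite /dG /GRing.scale /=; field.
suff : (psi l * l^-1 + c) * expR (- l) <= e + c.
  rewrite expRN ler_pdivrMr ?expR_gt0// -lerBrDr ler_pdivrMr//.
  by move=> /le_trans; apply; lra.
apply/ler_addgt0Pr => eps eps0.
(* A starting point so close to [0] that [init] gives [psi t / t <= e + eps]; the [+ 1] avoids
   division by zero. *)
pose t := Num.min (Num.min l r) (eps / (A + 1)).
have A1 : 0 < A + 1 by lra.
have t0 : 0 < t by rewrite !lt_min l0 r0 divr_gt0.
have tl : t <= l by rewrite !ge_min lexx.
have tr : t <= r by rewrite !ge_min lexx orbT.
have tA : t * A <= eps.
  have : t <= eps / (A + 1) by rewrite ge_min lexx orbT.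
  by rewrite ler_pdivlMr//; lra.
have : G t <= G l.
  apply: (@nonneg_derive_nondecreasing _ G dG) => // s /andP[ts sl].
    by apply: dGP; lra.
  have s0 : 0 < s by lra.
  rewrite /dG oppr_ge0 mulr_le0_ge0 ?expR_ge0// subr_le0.
  rewrite ler_pdivrMr ?exprn_gt0//.
  have -> : (psi s * s^-1 + c) * s ^+ 2 = s * psi s + s ^+ 2 * c.
    by field; rewrite gt_eqF.
  by have := ineq s s0; lra.
rewrite lerN2 => /le_trans; apply.
have psit : psi t * t^-1 <= e + eps.
  rewrite ler_pdivrMr//.
  have tt : 0 < t <= r by rewrite t0.
  have := init t tt; have := ler_wpM2l (ltW t0) tA; lra.
apply: (@le_trans _ _ ((e + eps + c) * expR (- t))).
  by rewrite ler_wpM2r ?expR_ge0// lerD2r.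
have : expR (- t) <= 1 by rewrite expR_le1; lra.
have : 0 <= e + eps + c by lra.
by move=> /ler_wpM2l h /h; lra.
Qed.

End herbst.

Section tail_bound.
Context {R : realType} {Om J : finType} (p : Om -> R) (n : nat) (j0 : J).
Context (h : J -> Om -> R) (s2 : R).
Hypothesis p0 : forall a, 0 <= p a.
Hypothesis p1 : \sum_a p a = 1.

Local Notation Ex := (@Ex R Om p n).
Local Notation supsum h := (@supsum R Om J n j0 h).

Lemma is_derive_mgf (Z : {ffun 'I_n -> Om} -> R) (l : R) :
  is_derive l 1 (fun l : R => Ex (fun w => expR (l * Z w)))
    (Ex (fun w => Z w * expR (l * Z w))).
Proof.
rewrite /Ex.
have -> : (fun l : R => \sum_w weight p w * expR (l * Z w)) =
    \sum_w (fun l : R => weight p w * expR (l * Z w)).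
  by apply/funext => x; rewrite fct_sumE.
apply: (big_ind2 (fun (f : R -> R) df => is_derive l 1 f df)).
- exact: is_derive_cst.
- by move=> f df g dg *; exact: is_deriveD.
- by move=> w _; apply: is_derive_eq; rewrite /GRing.scale /=; lra.
Qed.

(** Supplies the initial condition of [herbst]: [r] is the inverse of a bound on [Z], so [l Z <= 1]
    and [expR_le_quadratic] applies, with [A] the second moment. *)
Lemma Ex_expR_le (Z : {ffun 'I_n -> Om} -> R) : exists2 r, 0 < r &
  exists2 A, 0 <= A & forall l, 0 < l <= r ->
  Ex (fun w => expR (l * Z w)) <= 1 + (l * Ex Z + l ^+ 2 * A).
Proof.
pose B := \sum_w `|Z w| + 1.
have B0 : 0 < B by rewrite ltr_wpDl// sumr_ge0.
have ZB w : Z w <= B.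
  rewrite /B (bigD1 w)//= (le_trans (ler_norm _))// -addrA lerDl.
  by rewrite addr_ge0// sumr_ge0.
exists B^-1; first by rewrite invr_gt0.
exists (Ex (fun w => Z w ^+ 2)).
  by rewrite -(@Ex_cst _ _ p n p1 0); apply: le_Ex => // w; exact: sqr_ge0.
move=> l /andP[l0 lB]; rewrite -ExZ -(ExZ _ (l ^+ 2)) -ExD.
rewrite -{1}(@Ex_cst _ _ p n p1 1) -ExD.
apply: le_Ex => // w; rewrite addrA -exprMn; apply: expR_le_quadratic.
apply: (@le_trans _ _ (l * B)); first by rewrite ler_wpM2l// ltW.
by rewrite -ler_pdivlMr// mul1r.
Qed.

Lemma chernoff (Z : {ffun 'I_n -> Om} -> R) (l c : R) : 0 <= l ->
  Ex (fun w => (c <= Z w)%R%:R) <=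
  Ex (fun w => expR (l * Z w)) * expR (- (l * c)).
Proof.
move=> l0; rewrite mulrC -ExZ; apply: le_Ex => // w; rewrite -expRD.
have [cZ|_] := leP c (Z w); last exact: expR_ge0.
apply: (@le_trans _ _ (expR 0)); first by rewrite expR0.
by rewrite ler_expR; have := ler_wpM2l l0 cZ; lra.
Qed.

(** [herbst] for [psi = ln M], with [dpsi = M' / M]: its differential inequality is
    [supsum_entropy_le] divided by [M l]. *)
Lemma log_mgf_supsum_le l :
  (forall j a, h j a <= 1) -> (forall j, \sum_a p a * h j a = 0) ->
  (forall j, \sum_a p a * h j a ^+ 2 <= s2) -> 0 < l ->
  ln (Ex (fun w => expR (l * supsum h w))) <=
  l * (expR l * Ex (supsum h) + (expR l - 1) * (n%:R * s2 / 2)).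
Proof.
move=> h1 Eh Eh2; move: l.
have [r r0 [A A0 MA]] := Ex_expR_le (supsum h).
pose M (l : R) := Ex (fun w => expR (l * supsum h w)).
have M0 l : 0 < M l by apply: Ex_gt0 => // w; exact: expR_gt0.
apply: (@herbst R (fun l => ln (M l))
  (fun l => (M l)^-1 * Ex (fun w => supsum h w * expR (l * supsum h w)))
  _ _ A r) => //.
- by rewrite divr_ge0// mulr_ge0// (s2_ge0 j0 p0 Eh2).
- exact: Ex_supsum_ge0 Eh.
- move=> l l0.
  have dM := is_derive_mgf (supsum h) l.
  have dln := is_derive1_ln (M0 l).
  exact: (@is_derive1_comp _ (@ln R) M).
- move=> l l0.
  have := supsum_entropy_le n j0 p0 p1 h1 Eh Eh2 (ltW l0).
  rewrite -/(M l); move: (Ex (fun w => supsum h w * _)) => M1 ent.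
  rewrite -(ler_pM2l (M0 l)).
  have -> : M l * ((1 + l) * (l * ((M l)^-1 * M1) - ln (M l))) =
     (1 + l) * (l * M1 - M l * ln (M l)).
    by field; rewrite gt_eqF.
  have -> : M l * (l ^+ 2 * ((M l)^-1 * M1 + n%:R * s2 / 2)) =
     l ^+ 2 * (M1 + n%:R * s2 / 2 * M l).
    by field; rewrite gt_eqF.
  exact: ent.
- move=> l lr; have := MA l lr.
  rewrite -/(M l) -lerBlDl; apply: le_trans.
  have := @le_ln1Dx R (M l - 1); rewrite subrKC; apply.
  by rewrite ltrBrDl subrr.
Qed.

Lemma supsum_tail x :
  (forall j a, h j a <= 1) -> (forall j, \sum_a p a * h j a = 0) ->
  (forall j, \sum_a p a * h j a ^+ 2 <= s2) -> 0 < x ->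
  Ex (fun w => (3 * Ex (supsum h) + Num.sqrt (2 * x * (n%:R * s2)) + x
                <= supsum h w)%R%:R) <= expR (- x).
Proof.
move=> h1 Eh Eh2 x0.
have e0 : 0 <= Ex (supsum h) by exact: Ex_supsum_ge0 Eh.
have v0 : 0 <= n%:R * s2 by rewrite mulr_ge0// (s2_ge0 j0 p0 Eh2).
set v := n%:R * s2 in v0 *.
set e := Ex (supsum h) in e0 *.
set c := 3 * e + _ + x.
suff [l /andP[l0 l1] lc] : exists2 l, 0 < l <= 1 &
    l * (expR l - 1) * v / 2 + x <= l * (Num.sqrt (2 * x * v) + x).
  apply: (le_trans (chernoff (supsum h) c (ltW l0))).
  have M0 : 0 < Ex (fun w => expR (l * supsum h w)).
    by apply: Ex_gt0 => // w; exact: expR_gt0.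
  rewrite -{1}(lnK M0) -expRD ler_expR.
  have := log_mgf_supsum_le h1 Eh Eh2 l0.
  rewrite -/e -/v.
  (* The factor [3] in front of the mean originates in this bound for [l <= 1]. *)
  have el3 : expR l <= 3.
    rewrite (le_trans (expR_le_quadratic l1))//.
    by have := mulr_ile1 (ltW l0) (ltW l0) l1 l1; lra.
  have : l * (expR l * e) <= l * (3 * e) by rewrite !ler_wpM2l ?ler_wpM2r// ltW.
  by rewrite /c; lra.
(* [l = 1] works if [v <= 2 x], and [l = sqrt (2 x / v)] otherwise *)
set s := Num.sqrt (2 * x * v).
have s0 : 0 <= s by exact: sqrtr_ge0.
have ss : s ^+ 2 = 2 * x * v.
  by rewrite sqr_sqrtr// mulr_ge0// mulr_ge0// ltW.
have [vx|xv] := leP v (2 * x).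
  exists 1; first by rewrite ltr01 lexx.
  have vs : v <= s by rewrite -ler_sqr ?nnegrE// ss expr2 ler_wpM2r.
  have := @expR_le_quadratic R 1 (lexx _); rewrite expr1n => e3.
  have : (expR 1 - 1) * v <= 2 * v by rewrite ler_wpM2r//; lra.
  by lra.
have v00 : 0 < v by lra.
have s00 : 0 < s by rewrite sqrtr_gt0 mulr_gt0// mulr_gt0.
have sv : s <= v.
  by rewrite -ler_sqr ?nnegrE// ss expr2; apply: ler_wpM2r => //; apply: ltW.
have l1 : s / v <= 1 by rewrite ler_pdivrMr// mul1r.
exists (s / v); first by rewrite divr_gt0.
have := expR_le_quadratic l1.
have lv : s / v * v = s by rewrite divfK// gt_eqF.
have ls : s / v * s = 2 * x by rewrite mulrAC -expr2 ss mulfK// gt_eqF.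
have l0 : 0 < s / v by rewrite divr_gt0.
move: (s / v) l1 lv ls l0 => l l1 lv ls l0 el.
have -> : l * (s + x) = l * s + l * x by lra.
have -> : l * (expR l - 1) * v = l * v * (expR l - 1) by lra.
rewrite ls lv.
have : s * (expR l - 1) <= s * (l + l ^+ 2) by rewrite ler_wpM2l//; lra.
have -> : s * (l + l ^+ 2) = l * s * (1 + l) by lra.
rewrite ls; lra.
Qed.

End tail_bound.

Section scaled_tail.
Context {R : realType} {Om J : finType} (p : Om -> R) (n : nat) (j0 : J).
Hypothesis p0 : forall a, 0 <= p a.
Hypothesis p1 : \sum_a p a = 1.

Lemma ler_bool (a b : bool) : (a -> b) -> a%:R <= b%:R :> R.
Proof. by case: a b => [] [] // /(_ isT). Qed.

Lemma supsum_le (h : J -> Om -> R) (w : {ffun 'I_n -> Om}) (c : R) :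
  (forall j, \sum_i h j (w i) <= c) -> supsum j0 h w <= c.
Proof. by move=> /(_ (argmaxf j0 (hsum h w))). Qed.

Lemma le_supsum (h : J -> Om -> R) (w : {ffun 'I_n -> Om}) j :
  \sum_i h j (w i) <= supsum j0 h w.
Proof. exact: (@le_argmaxf _ _ j0 (hsum h w)). Qed.

Lemma supsumZ (h : J -> Om -> R) (w : {ffun 'I_n -> Om}) (c : R) : 0 <= c ->
  supsum j0 (fun j a => c * h j a) w = c * supsum j0 h w.
Proof.
move=> c0; apply/eqP; rewrite eq_le; apply/andP; split.
  by apply: supsum_le => j; rewrite -mulr_sumr ler_wpM2l// le_supsum.
rewrite {2}/supsum /hsum mulr_sumr.
exact: (@le_supsum (fun j a => c * h j a) w).
Qed.

(** By homogeneity, division by [U] reduces the claim to functions bounded above by [1]. *)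
Lemma bousquet_tail (h : J -> Om -> R) (s2 U x : R) :
  0 < U -> (forall j a, h j a <= U) -> (forall j, \sum_a p a * h j a = 0) ->
  (forall j, \sum_a p a * h j a ^+ 2 <= s2) -> 0 < x ->
  Ex p (fun w : {ffun 'I_n -> Om} => (3 * Ex p (supsum j0 h (n := n))
     + Num.sqrt (2 * x * (n%:R * s2)) + U * x <= supsum j0 h w)%R%:R)
  <= expR (- x).
Proof.
move=> U0 hU Eh Eh2 x0.
pose h' j a := U^-1 * h j a.
have U0' : 0 <= U^-1 by rewrite invr_ge0 ltW.
have := @supsum_tail R Om J p n j0 h' (U^-1 ^+ 2 * s2) p0 p1 x _ _ _ x0.
have -> : Ex p (supsum j0 h' (n := n)) = U^-1 * Ex p (supsum j0 h (n := n)).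
  by rewrite -ExZ; apply: eq_Ex => w; rewrite supsumZ.
move=> H.
apply: le_trans (H _ _ _).
- apply: le_Ex => // w; apply: ler_bool => Hw.
  rewrite supsumZ//.
  have -> : 2 * x * (n%:R * (U^-1 ^+ 2 * s2)) = U^-1 ^+ 2 * (2 * x * (n%:R * s2)).
    by lra.
  rewrite sqrtrM ?sqr_ge0// sqrtr_sqr ger0_norm//.
  have -> : 3 * (U^-1 * Ex p (supsum j0 h (n := n)))
     + U^-1 * Num.sqrt (2 * x * (n%:R * s2)) + x =
     U^-1 * (3 * Ex p (supsum j0 h (n := n))
     + Num.sqrt (2 * x * (n%:R * s2)) + U * x).
    by field; rewrite gt_eqF.
  by rewrite ler_wpM2l.
- by move=> j a; rewrite /h' mulrC ler_pdivrMr// mul1r.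
- by move=> j; under eq_bigr do rewrite mulrCA; rewrite -mulr_sumr Eh mulr0.
- move=> j; under eq_bigr do rewrite exprMn mulrCA.
  by rewrite -mulr_sumr ler_wpM2l// sqr_ge0.
Qed.

End scaled_tail.

(** * From finite to general probability spaces *)

Section integral_monotone.
Context d (T : measurableType d) (R : realType) (mu : {measure set T -> \bar R}).

(* [f2] will be the supremum in [modulus], which may fail to be measurable *)
Lemma ge0_le_integralT (f1 f2 : T -> \bar R) :
  (forall x, 0%E <= f1 x)%E -> (forall x, f1 x <= f2 x)%E ->
  (\int[mu]_x f1 x <= \int[mu]_x f2 x)%E.
Proof.
move=> f10 f12; rewrite !ge0_integralTE//; last first.
  by move=> x; exact: le_trans (f12 x).
apply: le_ereal_sup => _ [h /= hf <-]; exists h => //= x.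
exact: le_trans (f12 x).
Qed.

End integral_monotone.

Section finite_law.
Context d (T : measurableType d) (R : realType) (mu : probability T R).
Context (A : finType) (X : T -> A).
Hypothesis mX : forall a, measurable (X @^-1` [set a]).

Definition law (a : A) : R := fine (mu (X @^-1` [set a])).

Lemma lawE a : mu (X @^-1` [set a]) = (law a)%:E.
Proof. by rewrite fineK// fin_num_measure. Qed.

Lemma law_ge0 a : 0 <= law a.
Proof. by rewrite fine_ge0. Qed.

Let decomp (phi : A -> R) t :
  (phi (X t))%:E = (\sum_a (phi a)%:E * (\1_(X @^-1` [set a]) t)%:E)%E.
Proof.
rewrite (bigD1 (X t))//= indicE mem_set//= mule1 big1 ?adde0// => a aX.
by rewrite indicE memNset ?mule0//= => /esym/eqP; apply/negP.
Qed.

Let int_term (phi : A -> R) a :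
  mu.-integrable setT (fun t => (phi a)%:E * (\1_(X @^-1` [set a]) t)%:E)%E.
Proof.
apply: integrableZl => //.
by apply: integrable_indic => //; rewrite -ge0_fin_numE ?fin_num_measure.
Qed.

Lemma integrable_law (phi : A -> R) :
  mu.-integrable setT (fun t => (phi (X t))%:E).
Proof.
under eq_fun do rewrite decomp.
by apply: integrable_sum => // a _; exact: int_term.
Qed.

Lemma integral_law (phi : A -> R) :
  (\int[mu]_t (phi (X t))%:E)%E = (\sum_a law a * phi a)%:E.
Proof.
under eq_integral do rewrite decomp.
rewrite integral_sum//.
rewrite -sumEFin; apply: eq_bigr => a _.
rewrite integralZl//; last first.
  by apply: integrable_indic => //; rewrite -ge0_fin_numE ?fin_num_measure.
by rewrite integral_indic// setIT mulrC EFinM; congr (_ * _)%E; exact: lawE.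
Qed.

Lemma sum_law : \sum_a law a = 1.
Proof.
have := integral_law (fun=> 1).
rewrite integral_cst//= mul1e (@probability_setT _ _ _ mu) => -[->].
by apply: eq_bigr => a _; rewrite mulr1.
Qed.

End finite_law.

Section empirical_mean.
Context d (Z : measurableType d) (R : realType).

Lemma bounded_integrable (P : probability Z R) (f : Z -> R) (c : R) :
  measurable_fun setT f -> (forall z, `|f z| <= c) ->
  P.-integrable setT (EFin \o f).
Proof.
move=> mf fc; apply: measurable_bounded_integrable => //.
  by rewrite -ge0_fin_numE ?fin_num_measure.
exists c; split; first exact: num_real.
by move=> y cy z _; apply: le_trans (fc z) _; exact: ltW.
Qed.

Lemma sum_emp_mean (n : nat) (T : n.-tuple Z) (f : Z -> R) : (0 < n)%N ->
  \sum_(i < n) f (tnth T i) = n%:R * emp_mean T f.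
Proof. by move=> n0; rewrite /emp_mean mulVKf// pnatr_eq0 -lt0n. Qed.

Lemma measurable_emp_mean (n : nat) (g : Z -> R) : measurable_fun setT g ->
  measurable_fun setT (fun T : n.-tuple Z => emp_mean T g).
Proof.
move=> mg; apply: measurable_funM => //; apply: measurable_sum => i.
by apply: measurableT_comp => //; exact: measurable_tnth.
Qed.

End empirical_mean.

(** * Rounding finitely many functions to a grid *)

Section discretization.
Context d (Z : measurableType d) (R : realType) (P : probability Z R).
Context (n m : nat) (Q : probability (n.-tuple Z) R) (g : 'I_m.+1 -> Z -> R).
Context (K eps V delta : R).
Hypothesis delta0 : 0 < delta.
Hypothesis mg : forall k, measurable_fun setT (g k).
Hypothesis gK : forall k z, `|g k z| <= K.
Hypothesis Eg : forall k, expect P (g k) = eps.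
Hypothesis Eg2 : forall k, expect P (fun z => g k z ^+ 2) <= V.
Hypothesis epsK : eps <= K.

Let N := Num.truncn (2 * K / delta).
Let Om := {ffun 'I_m.+1 -> 'I_N.+1}.

(** The grid positions of all [g k z] at once. [inord] never falls back to its default, because
    [|g k z| <= K] keeps each position at most [N]. *)
Definition cell (z : Z) : Om :=
  [ffun k => inord (Num.truncn ((g k z + K) / delta))].

Definition rep (k : 'I_m.+1) (a : Om) : R := delta * (a k)%:R - K.

Let scaled_ge0 k z : 0 <= (g k z + K) / delta.
Proof.
rewrite divr_ge0 ?(ltW delta0)//.
by have := gK k z; rewrite ler_norml => /andP[]; lra.
Qed.

Lemma cell_val k z : cell z k = Num.truncn ((g k z + K) / delta) :> nat.
Proof.
rewrite ffunE inordK// ltnS; apply: le_truncn.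
rewrite ler_pM2r ?invr_gt0//.
by have := gK k z; rewrite ler_norml => /andP[]; lra.
Qed.

Lemma cellP z a : cell z = a <->
  forall k, (a k)%:R <= (g k z + K) / delta < (a k).+1%:R.
Proof.
split=> [<- k|H].
  by rewrite cell_val; exact: truncn_itv.
by apply/ffunP => k; apply/val_inj; rewrite /= cell_val; exact: truncn_def.
Qed.

Lemma rep_bounds k z : rep k (cell z) <= g k z <= rep k (cell z) + delta.
Proof.
have /(_ k) := (cellP z (cell z)).1 erefl.
rewrite ler_pdivlMr// ltr_pdivrMr// -natr1 /rep.
by move=> /andP[? ?]; apply/andP; split; lra.
Qed.

Lemma rep_ge k a : - K <= rep k a.
Proof. by rewrite /rep lerBrDr addNr mulr_ge0// ltW. Qed.

Lemma measurable_cell a : measurable (cell @^-1` [set a]).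
Proof.
have -> : cell @^-1` [set a] = \bigcap_(k in [set: 'I_m.+1])
    ((fun z => (g k z + K) / delta) @^-1` `[(a k)%:R, (a k).+1%:R[).
  apply/seteqP; split=> z /=.
    by move=> /cellP + k _ => /(_ k); rewrite /= in_itv.
  by move=> H; apply/cellP => k; have := H k I; rewrite /= in_itv.
apply: fin_bigcap_measurable => // k _.
rewrite -[X in measurable X]setTI.
apply: (_ : measurable_fun setT (fun z => (g k z + K) / delta)) => //.
apply: measurable_funM => //; exact: measurable_funD.
Qed.

Definition cells (T : n.-tuple Z) : {ffun 'I_n -> Om} :=
  [ffun i => cell (tnth T i)].

Let cellsE w : cells @^-1` [set w] =
  [set T | forall i, (cell @^-1` [set w i]) (tnth T i)].
Proof.
apply/seteqP; split => T /=; first by move=> <- i; rewrite ffunE.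
by move=> H; apply/ffunP => i; rewrite ffunE H.
Qed.

Lemma measurable_cells w : measurable (cells @^-1` [set w]).
Proof.
have -> : cells @^-1` [set w] = \bigcap_(i in [set: 'I_n])
    ((fun T : n.-tuple Z => tnth T i) @^-1` (cell @^-1` [set w i])).
  by rewrite cellsE; apply/seteqP; split=> T /= H i; [move=> _|]; exact: H.
apply: fin_bigcap_measurable => // i _.
rewrite -[X in measurable X]setTI.
by apply: measurable_tnth => //; exact: measurable_cell.
Qed.

Let p := law P cell.

(** A fibre of [cells] is a measurable rectangle, so the product rule for [Q] determines its
    probability. *)
Lemma law_cells w : is_product_prob P Q -> law Q cells w = weight p w.
Proof.
move=> PQ; rewrite /law cellsE (PQ (fun i => cell @^-1` [set w i]));
  last by move=> i; exact: measurable_cell.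
rewrite /weight -[RHS]/(fine (\prod_(i < n) p (w i))%:E); congr fine.
elim/big_ind2 : _ => // [x1 x2 y1 y2 -> -> //|i _].
by rewrite lawE//; exact: measurable_cell.
Qed.

Lemma integral_cells (phi : {ffun 'I_n -> Om} -> R) : is_product_prob P Q ->
  (\int[Q]_T (phi (cells T))%:E)%E = (Ex p phi)%:E.
Proof.
move=> PQ; rewrite integral_law; last exact: measurable_cells.
by congr EFin; apply: eq_bigr => w _; rewrite law_cells.
Qed.

Let expect_cell (phi : Om -> R) : expect P (phi \o cell) = \sum_a p a * phi a.
Proof. by rewrite /expect /Rintegral integral_law//; exact: measurable_cell. Qed.

Let integrable_cell (phi : Om -> R) : P.-integrable setT (EFin \o (phi \o cell)).
Proof. by apply: integrable_law; exact: measurable_cell. Qed.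

Let int_g k : P.-integrable setT (EFin \o g k).
Proof. exact: (bounded_integrable P (mg k) (gK k)). Qed.

Let int_g2 k : P.-integrable setT (EFin \o (fun z => g k z ^+ 2)).
Proof.
apply: (@bounded_integrable _ _ _ P _ (K ^+ 2)); first exact: measurable_funX.
by move=> z; rewrite normrX lerXn2r ?nnegrE//; exact: le_trans (gK k z).
Qed.

Let expect_cst (c : R) : expect P (fun=> c) = c.
Proof.
by rewrite /expect /Rintegral integral_cst//= (@probability_setT _ _ _ P) mule1.
Qed.

Let int_cst (c : R) : P.-integrable setT (EFin \o (fun=> c)).
Proof. by apply: (@bounded_integrable _ _ _ P _ `|c|). Qed.

Definition rep_mean k := \sum_a p a * rep k a.

Lemma rep_mean_bounds k : eps - delta <= rep_mean k <= eps.
Proof.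
rewrite /rep_mean -expect_cell -(Eg k); apply/andP; split.
  rewrite -(expect_cst delta) -RintegralB//.
  apply: le_Rintegral => //.
    exact: (integrableB measurableT (int_g k) (int_cst delta)).
    exact: (integrable_cell (rep k)).
  by move=> z _ /=; have := rep_bounds k z; lra.
apply: le_Rintegral => //; first exact: (integrable_cell (rep k)).
move=> z _ /=.
by have := rep_bounds k z; lra.
Qed.

(** Between a value [y] and its rounding [r], [y^2 - r^2 = (y - r) (y + r)] with
    [0 <= y - r <= delta] and [y + r >= - 2 K]. *)
Lemma rep_sqr_mean k : \sum_a p a * rep k a ^+ 2 <= V + 2 * K * delta.
Proof.
rewrite -(expect_cell (fun a => rep k a ^+ 2)).
apply: (@le_trans _ _ (expect P (fun z => g k z ^+ 2 + 2 * K * delta))).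
  apply: le_Rintegral => //; first exact: (integrable_cell (fun a => rep k a ^+ 2)).
    exact: (integrableD measurableT (int_g2 k) (int_cst (2 * K * delta))).
  move=> z _ /=; have /andP[r1 r2] := rep_bounds k z; have := rep_ge k (cell z).
  have := gK k z; rewrite ler_norml => /andP[g1 g2].
  move: (rep k (cell z)) (g k z) r1 r2 g1 g2 => r y r1 r2 g1 g2 rK.
  rewrite -subr_ge0.
  have -> : y ^+ 2 + 2 * K * delta - r ^+ 2 =
    2 * K * (delta - (y - r)) + (y - r) * (2 * K + y + r) by lra.
  by rewrite addr_ge0// mulr_ge0//; lra.
rewrite /expect (RintegralD measurableT (int_g2 k) (int_cst (2 * K * delta))).
apply: lerD; first exact: Eg2.
by rewrite -[leLHS]/(expect P (fun=> 2 * K * delta)) expect_cst.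
Qed.

(** Centred with reversed sign, so that a small empirical mean of [g k] makes the sum of [h k]
    large. *)
Let h k a := rep_mean k - rep k a.

Lemma sum_h (T : n.-tuple Z) k :
  \sum_i h k (cells T i) = n%:R * rep_mean k - \sum_i rep k (cell (tnth T i)).
Proof.
rewrite sumrB sumr_const card_ord mulr_natl; congr (_ - _).
by apply: eq_bigr => i _; rewrite ffunE.
Qed.

Hypothesis n0 : (0 < n)%N.

Lemma sum_h_le (T : n.-tuple Z) k :
  \sum_i h k (cells T i) <= n%:R * (eps - emp_mean T (g k) + delta).
Proof.
rewrite sum_h mulrDr mulrBr -sum_emp_mean//.
have : n%:R * rep_mean k <= n%:R * eps.
  by rewrite ler_wpM2l//; have := rep_mean_bounds k; lra.
have : \sum_i g k (tnth T i) - n%:R * delta <= \sum_i rep k (cell (tnth T i)).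
  rewrite mulr_natl -[X in _ *+ X]card_ord -sumr_const -sumrB.
  by apply: ler_sum => i _; have := rep_bounds k (tnth T i); lra.
lra.
Qed.

Lemma sum_h_ge (T : n.-tuple Z) k :
  n%:R * (eps - emp_mean T (g k) - delta) <= \sum_i h k (cells T i).
Proof.
rewrite sum_h mulrBr mulrBr -sum_emp_mean//.
have : n%:R * (eps - delta) <= n%:R * rep_mean k.
  by rewrite ler_wpM2l//; have := rep_mean_bounds k; lra.
have : \sum_i rep k (cell (tnth T i)) <= \sum_i g k (tnth T i).
  by apply: ler_sum => i _; have := rep_bounds k (tnth T i); lra.
lra.
Qed.

(** An empirical mean below [delta] forces the rounded supremum above [n (eps - 2 delta)], one
    [delta] being the rounding error; [ineq] puts this above the threshold of [bousquet_tail]. *)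
Lemma tail_of_finite_family (x omega : R) (Sup : n.-tuple Z -> \bar R) :
  0 < x -> 0 < K -> is_product_prob P Q ->
  (forall k T, ((`|eps - emp_mean T (g k)|%R)%:E <= Sup T)%E) ->
  (\int[Q]_T Sup T <= omega%:E)%E ->
  3 * (n%:R * (omega + delta)) + Num.sqrt (2 * x * (n%:R * (V + 2 * K * delta)))
    + 2 * K * x <= n%:R * (eps - 2 * delta) ->
  (Q [set T | exists k, (emp_mean T (g k) < delta)%R] <= (expR (- x))%:E)%E.
Proof.
move=> x0 K0 PQ SupP Supo ineq.
have p0 a : 0 <= p a by exact: law_ge0.
have p1 : \sum_a p a = 1 by apply: sum_law; exact: measurable_cell.
have nR0 : 0 < n%:R :> R by rewrite ltr0n.
pose S := @supsum R Om 'I_m.+1 n ord0 h.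
(* From [rep_mean k <= eps <= K] and [rep k a >= - K]; this is the source of the [2] in the last
   term of the condition on [eps]. *)
have hU k a : h k a <= 2 * K.
  have /andP[_ re] := rep_mean_bounds k.
  rewrite lerBlDr (le_trans re)// (le_trans epsK)// -lerBlDl.
  have -> : K - 2 * K = - K by ring.
  exact: rep_ge.
have Eh k : \sum_a p a * h k a = 0.
  by under eq_bigr do rewrite mulrBr; rewrite sumrB -mulr_suml p1 mul1r subrr.
have Eh2 k : \sum_a p a * h k a ^+ 2 <= V + 2 * K * delta.
  apply: le_trans (rep_sqr_mean k).
  have -> : \sum_a p a * h k a ^+ 2 = \sum_a p a * rep k a ^+ 2 - rep_mean k ^+ 2.
    transitivity (\sum_a (p a * rep_mean k ^+ 2 + (p a * rep k a ^+ 2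
       - 2 * rep_mean k * (p a * rep k a)))).
      by apply: eq_bigr => a _; rewrite /h; lra.
    by rewrite big_split sumrB /= -mulr_suml p1 -mulr_sumr -/(rep_mean k); lra.
  by rewrite gerBl sqr_ge0.
have ES : Ex p S <= n%:R * (omega + delta).
  (* Subtracting the rounding error [delta] makes [phi (cells T) <= Sup T], and cutting at [0] gives
     the nonnegative integrand that monotonicity under a possibly nonmeasurable [Sup] asks for. *)
  pose phi w := Num.max 0 (n%:R^-1 * S w - delta).
  have Ephi : Ex p phi <= omega.
    rewrite -lee_fin -(integral_cells phi PQ); apply: le_trans Supo.
    apply: ge0_le_integralT => T; first by rewrite lee_fin le_max lexx.
    have := SupP ord0 T.
    case: (Sup T) (SupP ^~ T) => [s|_ _|_]//; last by rewrite leey.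
    move=> H _; rewrite lee_fin /phi ge_max; apply/andP; split.
      by have := H ord0; rewrite lee_fin; apply: le_trans.
    rewrite lerBlDr mulrC ler_pdivrMr// mulrC; apply: supsum_le => k.
    apply: (le_trans (sum_h_le T k)); rewrite ler_wpM2l// lerD2r.
    by have := H k; rewrite lee_fin; apply: le_trans; exact: ler_norm.
  apply: (@le_trans _ _ (Ex p (fun w => n%:R * phi w + n%:R * delta))).
    apply: le_Ex => // w; rewrite -mulrDr -ler_pdivrMl//.
    by rewrite -lerBlDr /phi le_max lexx orbT.
  rewrite ExD (ExZ _ _ phi) (Ex_cst _ p1) mulrDr lerD2r.
  by apply: ler_wpM2l => //; exact: ltW.
have mA : measurable
    [set T : n.-tuple Z | exists k, emp_mean T (g k) < delta].
  have -> : [set T : n.-tuple Z | exists k, emp_mean T (g k) < delta] =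
      \bigcup_(k in [set: 'I_m.+1])
        ((fun T : n.-tuple Z => emp_mean T (g k)) @^-1` `]-oo, delta[).
    apply/seteqP; split=> T /=.
      by move=> [k kd]; exists k => //=; rewrite in_itv.
    by move=> [k _ /=]; rewrite in_itv/= => kd; exists k.
  apply: fin_bigcup_measurable => // k _.
  rewrite -[X in measurable X]setTI.
  exact: (measurable_emp_mean (mg k)).
rewrite -[X in Q X]setIT -(integral_indic Q measurableT)//.
pose c := 3 * Ex p S + Num.sqrt (2 * x * (n%:R * (V + 2 * K * delta)))
  + 2 * K * x.
apply: (@le_trans _ _ (\int[Q]_T ((c <= S (cells T))%R%:R)%:E)%E).
  apply: ge0_le_integralT => T; first by rewrite lee_fin indicE ler0n.
  rewrite lee_fin indicE; apply: ler_bool => /set_mem/= [k kd].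
  apply: le_trans (le_supsum ord0 h (cells T) k).
  apply: le_trans (sum_h_ge T k).
  apply: (@le_trans _ _ (n%:R * (eps - 2 * delta))).
    by apply: le_trans ineq; rewrite /c; lra.
  by rewrite ler_wpM2l//; lra.
rewrite (integral_cells (fun w => (c <= S w)%R%:R) PQ) lee_fin.
by apply: bousquet_tail => //; rewrite mulr_gt0.
Qed.

End discretization.

(** * Localization at excess risk [eps] *)

Section separability.
Context {R : realType} {d : measure_display} {Z : measurableType d}.

(* subsets of separable sets are separable: near each dense point choose an
   element of the subset whenever there is one *)
Lemma sup_separable_subset_seq (G H : set (Z -> R)) :
  sup_separable G -> H `<=` G -> H !=set0 ->
  exists u : nat -> Z -> R, (forall k, H (u k)) /\
    forall g, H g -> forall e : R, 0 < e ->
    exists k, forall z, `|g z - u k z| < e.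
Proof.
move=> [D [/countable_injP[c cinj] [DG Ddense]]] HG [h0 Hh0].
pose near_code (k : nat * nat) (h : Z -> R) :=
  exists2 f, D f & c f = k.1 /\ forall z, `|f z - h z| < k.2.+1%:R^-1.
have pick_ex (k : nat * nat) : exists h, H h /\
    ((exists2 h', H h' & near_code k h') -> near_code k h).
  have [[h Hh kh]|nkh] := pselect (exists2 h, H h & near_code k h).
    by exists h.
  by exists h0; split => // /nkh.
have [v vP] := choice pick_ex.
(* Indices encode pairs of a dense point and a precision. The default pair is harmless, since every
   value of [v] lies in [H]. *)
exists (fun k => v (odflt (0, 0)%N (unpickle k))); split.
  by move=> k; case: (vP (odflt (0, 0)%N (unpickle k))).
move=> g Hg e e0.
have [j je] : exists j : nat, j.+1%:R^-1 < e / 2.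
  exists (Num.truncn (e / 2)^-1).
  rewrite invf_plt ?posrE ?divr_gt0//; exact: truncnS_gt.
have j0 : 0 < j.+1%:R^-1 :> R by rewrite invr_gt0.
have [f Df fg] := Ddense g (HG _ Hg) _ j0.
exists (pickle (c f, j)) => z; rewrite pickleK/=.
have [_ /(_ _)[]] := vP (c f, j).
  exists g => //; exists f => //; split => // y.
  by rewrite distrC.
move=> f' Df' [/= /cinj cff' f'v].
have {}cff' : f' = f by apply: cff'; exact: mem_set.
rewrite cff' in f'v.
apply: (le_lt_trans (ler_distD (f z) _ _)).
have := fg z; have := f'v z; move: je; rewrite /=.
by move: (j.+1%:R^-1) => q; lra.
Qed.

End separability.

Section level_crossing.
Context {R : realType} {d : measure_display} {Z : measurableType d}.
Context (F : set (Z -> R)) (C : (Z -> R) -> Z -> R) (P : probability Z R).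
Hypothesis convF : convex_fset F.
Hypothesis costC : cost_function F C.
Hypothesis convC : convex_cost F C.
Hypothesis lineC : line_continuous F C.
Hypothesis intC : forall f, F f -> P.-integrable setT (EFin \o C f).

(** Continues the segment parameter constantly beyond [[0, 1]], so that continuity under the
    integral can be applied on a larger interval and covers both endpoints. *)
Definition clamp (t : R) : R := Num.max 0 (Num.min t 1).

Lemma clamp_itv t : 0 <= clamp t <= 1.
Proof. by rewrite /clamp le_max lexx ge_max ler01 ge_min lexx orbT. Qed.

Lemma clamp_id t : 0 <= t <= 1 -> clamp t = t.
Proof. by move=> /andP[t0 t1]; rewrite /clamp min_l// max_r. Qed.

Lemma continuous_clamp : continuous clamp.
Proof.
move=> t; apply: (@continuous_max R R (fun=> 0) (id \min (fun=> 1))).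
  exact: cst_continuous.
apply: (@continuous_min R R id (fun=> 1)); last exact: cst_continuous.
exact: cvg_id.
Qed.

(** Dominated convergence: by convexity and nonnegativity of the cost, [C f1 + C f0] dominates the
    cost along the segment. *)
Lemma continuous_risk_segment f0 f1 : F f0 -> F f1 ->
  {within `[0, 1],
    continuous (fun t : R => expect P (C (lincomb (clamp t) f1 f0)))}.
Proof.
move=> Ff0 Ff1.
have Ft t : F (lincomb (clamp t) f1 f0) by apply: convF => //; exact: clamp_itv.
have cont z : continuous (fun t : R => C (lincomb (clamp t) f1 f0) z).
  move=> t; have := @lineC z f1 f0 Ff1 Ff0.
  move=> /subspace_continuousP /(_ (clamp t)); rewrite /= in_itv/= clamp_itv.
  move=> /(_ isT) H.
  move=> W /H /= WH; have cW := @continuous_clamp t _ WH.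
  apply: (@filterS _ (nbhs (t : R)) _ _ _ _ cW) => s /= sW.
  by apply: sW; rewrite in_itv/= clamp_itv.
apply: continuous_in_subspaceT => t t01.
apply: (@continuity_under_integral _ _ _ P (fun t z => C (lincomb (clamp t) f1 f0) z)
  setT measurableT (-1) 2 _ _ (fun z => C f1 z + C f0 z)).
- by move=> s _; exact: intC.
- by apply: aeW => z _ s _; exact: cont.
- by have := integrableD measurableT (intC Ff1) (intC Ff0).
- move=> s _; apply: aeW => z _; have [c0 _] := costC (Ft s).
  rewrite ger0_norm//.
  have /andP[s0 s1] := clamp_itv s.
  have := @convC z f1 f0 _ Ff1 Ff0 (clamp_itv s).
  have [c1 _] := costC Ff1; have [c2 _] := costC Ff0.
  have := ler_wpM2r (c1 z) s1.
  have := mulr_ge0 s0 (c2 z); lra.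
- by move: t01; rewrite !inE/= !in_itv/=; lra.
Qed.

Lemma level_crossing f0 f1 v : F f0 -> F f1 ->
  expect P (C f0) <= v <= expect P (C f1) ->
  exists f, exists2 t, 0 <= t <= 1 & [/\ F f, expect P (C f) = v &
    forall z, C f z <= t * C f1 z + (1 - t) * C f0 z].
Proof.
move=> Ff0 Ff1 /andP[v0 v1].
have l0 : lincomb (clamp 0) f1 f0 = f0.
  by rewrite clamp_id ?lexx ?ler01// /lincomb; apply/funext => z; lra.
have l1 : lincomb (clamp 1) f1 f0 = f1.
  by rewrite clamp_id ?lexx ?ler01// /lincomb; apply/funext => z; lra.
have [|t _ tv] := IVT ler01 (continuous_risk_segment Ff0 Ff1) (v := v).
  by rewrite l0 l1 ge_min v0 le_max v1 orbT.
exists (lincomb (clamp t) f1 f0); exists (clamp t); first exact: clamp_itv.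
split=> //; first by apply: convF => //; exact: clamp_itv.
by move=> z; apply: convC => //; exact: clamp_itv.
Qed.

End level_crossing.

(** * Measurable covers of the bad event *)

Section outer_probability.
Context {R : realType} {d : measure_display} {Z : measurableType d}.

(** A measurable cover of [E] has its complement inside [A], hence probability at least [1 - Q A];
    [E] itself may be nonmeasurable. *)
Lemma outer_prob_ge (n : nat) (Q : probability (n.-tuple Z) R)
    (E A : set (n.-tuple Z)) (y : R) :
  measurable A -> ~` E `<=` A -> (Q A <= y%:E)%E ->
  ((1 - y)%:E <= outer_prob Q E)%E.
Proof.
move=> mA EA QA; apply/ereal_infP => _ [A' /= [mA' EA'] <-].
have AA : ~` A' `<=` A by move=> T nA'T; apply: EA => /EA'.
have : (Q (~` A') <= Q A)%E.
  by apply: le_measure; rewrite ?inE//; exact: measurableC.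
rewrite probability_setC// => /le_trans /(_ QA).
by rewrite EFinB !leeBlDr ?fin_num_measure// addeC.
Qed.

End outer_probability.

Section bad_event.
Context {R : realType} {d : measure_display} {Z : measurableType d}.
Context (P : probability Z R) (n : nat) (Q : probability (n.-tuple Z) R).
Context (u : nat -> Z -> R) (K eps V : R).
Hypothesis mu : forall k, measurable_fun setT (u k).
Hypothesis uK : forall k z, `|u k z| <= K.
Hypothesis Eu : forall k, expect P (u k) = eps.
Hypothesis Eu2 : forall k, expect P (fun z => u k z ^+ 2) <= V.
Hypothesis eps0 : 0 < eps.
Hypothesis n0 : (0 < n)%N.
Hypothesis PQ : is_product_prob P Q.

(** A positive threshold [delta] in place of [0] lets a countable family stand in for every function
    it approximates uniformly, which keeps the event measurable. *)
Definition low_mean (delta : R) : set (n.-tuple Z) :=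
  [set T | exists k, emp_mean T (u k) < delta].

Lemma measurable_low_mean1 k delta :
  measurable [set T : n.-tuple Z | emp_mean T (u k) < delta].
Proof.
rewrite [X in measurable X](_ : _ =
    (fun T : n.-tuple Z => emp_mean T (u k)) @^-1` `]-oo, delta[); last first.
  by apply/seteqP; split=> T /=; rewrite in_itv.
by rewrite -[X in measurable X]setTI; exact: (measurable_emp_mean (mu k)).
Qed.

Lemma measurable_low_mean delta : measurable (low_mean delta).
Proof.
have -> : low_mean delta =
    \bigcup_k [set T : n.-tuple Z | emp_mean T (u k) < delta].
  by apply/seteqP; split=> T [k]; [exists k|exists k].
by apply: bigcup_measurable => k _; exact: measurable_low_mean1.
Qed.

Lemma eps_le_bound : eps <= K.
Proof.
rewrite -(Eu 0%N).
have -> : K = expect P (fun=> K).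
  by rewrite /expect /Rintegral integral_cst//= (@probability_setT _ _ _ P) mule1.
apply: le_Rintegral => //.
- exact: (bounded_integrable P (mu 0%N) (uK 0%N)).
- exact: (@bounded_integrable _ _ _ P (fun=> K) `|K|).
- by move=> z _; apply: le_trans (ler_norm _) (uK _ _).
Qed.

(** Continuity from below: the events of the first [m + 1] functions increase to [low_mean delta],
    and the bound of [tail_of_finite_family] is uniform in [m]. *)
Lemma low_mean_tail (x delta omega : R) (Sup : n.-tuple Z -> \bar R) :
  0 < x -> 0 < delta ->
  (forall k T, ((`|eps - emp_mean T (u k)|%R)%:E <= Sup T)%E) ->
  (\int[Q]_T Sup T <= omega%:E)%E ->
  3 * (n%:R * (omega + delta)) + Num.sqrt (2 * x * (n%:R * (V + 2 * K * delta)))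
    + 2 * K * x <= n%:R * (eps - 2 * delta) ->
  (Q (low_mean delta) <= (expR (- x))%:E)%E.
Proof.
move=> x0 delta0 SupP Supo ineq.
have K0 : 0 < K by exact: lt_le_trans eps_le_bound.
pose A m := [set T : n.-tuple Z | exists k : 'I_m.+1, emp_mean T (u k) < delta].
have UA : low_mean delta = \bigcup_m A m.
  apply/seteqP; split=> T.
    by move=> [k kd]; exists k => //; exists ord_max.
  by move=> [m _ [k kd]]; exists k.
have mA m : measurable (A m).
  have -> : A m = \bigcup_(k in [set: 'I_m.+1])
      [set T : n.-tuple Z | emp_mean T (u k) < delta].
    by apply/seteqP; split=> T [k]; [exists k|exists k].
  by apply: fin_bigcup_measurable => // k _; exact: measurable_low_mean1.
have ndA : {homo A : m m' / (m <= m')%N >-> (m <= m')%O}.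
  move=> m m' mm'; apply/subsetPset => T [k kd].
  by exists (@widen_ord m.+1 m'.+1 mm' k).
have mU : measurable (\bigcup_m A m) by rewrite -UA; exact: measurable_low_mean.
have cvgQ := nondecreasing_cvg_mu (mu := Q) mA mU ndA.
rewrite UA -(cvg_lim _ cvgQ)//; apply: lime_le.
  by apply/cvg_ex; eexists; exact: cvgQ.
apply: nearW => m /=.
apply: (@tail_of_finite_family _ Z R P n m Q (fun k => u k) K eps V delta
   delta0 _ _ _ _ eps_le_bound n0 x omega Sup) => //.
Qed.

End bad_event.

Section slack.
Context {R : realType}.

Lemma sqrtrD_le (a b : R) : 0 <= a -> 0 <= b ->
  Num.sqrt (a + b) <= Num.sqrt a + Num.sqrt b.
Proof.
move=> a0 b0; rewrite -ler_sqr ?nnegrE ?addr_ge0 ?sqrtr_ge0//.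
rewrite sqrrD !sqr_sqrtr ?addr_ge0// addrAC lerDl.
by rewrite mulrn_wge0// mulr_ge0 ?sqrtr_ge0.
Qed.

(* lowering [x] to [x'] leaves room for the discretization step [delta] *)
Lemma exists_delta (N K V eps omega x x' : R) :
  0 < N -> 0 < K -> 0 <= V -> 0 < x' -> x' < x ->
  3 * omega + (Num.sqrt (2 * x * V / N) + 2 * x * K / N) <= eps ->
  exists2 delta : R, 0 < delta &
    3 * (N * (omega + delta)) + Num.sqrt (2 * x' * (N * (V + 2 * K * delta)))
      + 2 * K * x' <= N * (eps - 2 * delta).
Proof.
move=> N0 K0 V0 x'0 x'x ineq.
have x0 : 0 < x by exact: lt_trans x'x.
pose s := Num.sqrt (4 * x * N * K).
have s0 : 0 <= s by exact: sqrtr_ge0.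
pose r := 2 * K * (x - x').
have r0 : 0 < r by rewrite !mulr_gt0// subr_gt0.
have q0 : 0 < 5 * N + s by rewrite ltr_wpDr// mulr_gt0.
(* With [delta = t^2] the error under the root becomes the linear term [t * s]. The [5] counts
   [3 delta] next to [omega] and [2 delta] next to [eps]; [r] is the room gained from [x' < x]. *)
pose t := Num.min 1 (r / (5 * N + s)).
have t0 : 0 < t by rewrite lt_min ltr01 divr_gt0.
have t1 : t <= 1 by rewrite ge_min lexx.
have tr : t * (5 * N + s) <= r.
  by rewrite -ler_pdivlMr// ge_min lexx orbT.
exists (t ^+ 2); first exact: exprn_gt0.
have tt : t ^+ 2 <= t by rewrite expr2 ler_piMl// ltW.
have sq : Num.sqrt (2 * x' * (N * (V + 2 * K * t ^+ 2))) <=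
    N * Num.sqrt (2 * x * V / N) + t * s.
  apply: (@le_trans _ _ (Num.sqrt (N ^+ 2 * (2 * x * V / N) +
     t ^+ 2 * (4 * x * N * K)))).
    apply: ler_wsqrtr.
    have -> : N ^+ 2 * (2 * x * V / N) + t ^+ 2 * (4 * x * N * K) =
       2 * x * (N * (V + 2 * K * t ^+ 2)).
      by field; rewrite gt_eqF.
    rewrite ler_wpM2r ?ler_pM2l ?(ltW x'x)//.
    by rewrite mulr_ge0 ?(ltW N0)// addr_ge0// !mulr_ge0 ?sqr_ge0// ltW.
  apply: (le_trans (sqrtrD_le _ _)).
  - by rewrite mulr_ge0 ?sqr_ge0// divr_ge0 ?(ltW N0)// mulr_ge0// mulr_ge0// ltW.
  - by rewrite mulr_ge0 ?sqr_ge0// mulr_ge0 ?(ltW K0)// mulr_ge0 ?(ltW N0)//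
      mulr_ge0// ltW.
  rewrite (sqrtrM _ (sqr_ge0 N)) (sqrtrM _ (sqr_ge0 t)) !sqrtr_sqr.
  by rewrite !ger0_norm ?(ltW t0) ?(ltW N0).
have := ler_wpM2l (ltW N0) ineq.
have -> : N * (3 * omega + (Num.sqrt (2 * x * V / N) + 2 * x * K / N)) =
   3 * N * omega + N * Num.sqrt (2 * x * V / N) + 2 * x * K.
  by field; rewrite gt_eqF.
have : 5 * N * t ^+ 2 <= 5 * N * t by rewrite ler_pM2l// mulr_gt0.
move: sq tr; rewrite /r; lra.
Qed.

End slack.

(** * From the excess risk of the empirical minimizer to the tail bound *)

Unset Implicit Arguments.

Theorem theorem3p1 (R : realType) (d : measure_display) (Z : measurableType d)
  (F : set (Z -> R)) (C : (Z -> R) -> Z -> R) (P : probability Z R)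
  (fP : Z -> R) (fT : forall n : nat, n.-tuple Z -> (Z -> R))
  (b B beta w W nu theta : R) :
  convex_fset F ->
  (forall f, F f -> bounded_fun f /\ measurable_fun setT f) ->
  cost_function F C -> convex_cost F C -> line_continuous F C ->
  F fP -> (forall f, F f -> (risk P C fP <= risk P C f)%E) ->
  (risk P C fP < +oo)%E ->
  (forall n (T : n.-tuple Z), (1 <= n)%N ->
     F (fT n T) /\ forall f, F f -> emp_risk C T (fT n T) <= emp_risk C T f) ->
  let G := [set (fun z => C f z - C fP z) | f in F] in
  sup_separable G ->
  0 <= b -> 0 <= B -> 0 <= beta <= 1 -> 0 <= w -> 0 <= W ->
  0 <= nu <= 2 -> 0 <= theta < 2 ->
  (forall g, G g ->
     (forall z, `|g z| <= b * expect P g `^ beta + B) /\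
     expect P (fun z => g z ^+ 2)
       <= (b * expect P g `^ beta + B) `^ nu * (w * expect P g `^ theta + W)) ->
  forall (n : nat) (x eps : R) (Q : probability (n.-tuple Z) R),
    (1 <= n)%N -> 1 <= x -> 0 < eps -> is_product_prob P Q ->
    (eps%:E >= 3%:E * modulus P Q G eps
       + (Num.sqrt (2 * x * (b * eps `^ beta + B) `^ nu * (w * eps `^ theta + W) / n%:R)
          + 2 * x * (b * eps `^ beta + B) / n%:R)%:E)%E ->
    (outer_prob Q [set T | (risk P C (fT n T) < risk P C fP + eps%:E)%E]
       >= (1 - expR (- x))%:E)%E.
Proof.
move=> convF _ costC convC lineC FfP fPmin fPfin fTmin G sepG b0 B0 _ w0 W0 _ _ GP.
move=> n x eps Q n1 x1 eps0 PQ hyp.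
have n0 : 0 < n%:R :> R by rewrite ltr0n.
have fP0 := (costC _ FfP).1; have mfP := (costC _ FfP).2.
have intfP : P.-integrable setT (EFin \o C fP).
  apply/integrableP; split; first exact/measurable_EFinP.
  under eq_integral do rewrite /= ger0_norm//.
  exact: fPfin.
have mG f : F f -> measurable_fun setT (fun z => C f z - C fP z).
  by move=> Ff; apply: measurable_funB => //; exact: (costC _ Ff).2.
(* The costs themselves may be unbounded: integrability of [C f] comes from the sup-norm bound on
   [C f - C fP] and the finite risk of [fP]. *)
have intG f : F f -> P.-integrable setT (EFin \o (fun z => C f z - C fP z)).
  move=> Ff; have [] := GP (fun z => C f z - C fP z); first by exists f.
  by move=> gb _; exact: (bounded_integrable P (mG f Ff) gb).
have intC f : F f -> P.-integrable setT (EFin \o C f).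
  move=> Ff; have -> : C f = (fun z => (C f z - C fP z) + C fP z).
    by apply/funext => z; rewrite subrK.
  exact: (integrableD measurableT (intG f Ff) intfP).
have riskE f : F f -> risk P C f = (expect P (C f))%:E.
  by move=> Ff; rewrite fineK//; exact: integrable_fin_num (intC f Ff).
have expectG f : F f ->
    expect P (fun z => C f z - C fP z) = expect P (C f) - expect P (C fP).
  by move=> Ff; rewrite /expect (RintegralB measurableT (intC f Ff) intfP).
pose H := [set g | G g /\ expect P g = eps].
pose bad := ~` [set T | (risk P C (fT n T) < risk P C fP + eps%:E)%E].
have badH (T : n.-tuple Z) : bad T -> exists2 g, H g & emp_mean T g <= 0.
  have [FT Tmin] := fTmin n T n1.
  move=> /negP; rewrite /= !riskE// -EFinD lte_fin -leNgt => crossing.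
  have [|f [t /andP[t0 t1] [Ff Ef fconv]]] := level_crossing convF costC convC lineC
     intC (v := expect P (C fP) + eps) FfP FT.
    by rewrite lerDl (ltW eps0).
  exists (fun z => C f z - C fP z).
    by split; [exists f|rewrite expectG// Ef addrAC subrr add0r].
  (* Convexity bounds [C f - C fP] pointwise by [t] times the same difference for [fT n T], whose
     empirical mean is at most [0] by minimality. *)
  apply: (@le_trans _ _ (t * (emp_risk C T (fT n T) - emp_risk C T fP))); last first.
    by rewrite mulr_ge0_le0// subr_le0 Tmin.
  rewrite /emp_risk /emp_mean -mulrBr mulrCA ler_wpM2l ?invr_ge0 ?ler0n//.
  rewrite -sumrB mulr_sumr; apply: ler_sum => i _.
  by have := fconv (tnth T i); lra.
have mod0 : (0 <= modulus P Q G eps)%E.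
  apply: integral_ge0 => T _.
  pose g0 := (fun z => C fP z - C fP z).
  apply: (@le_trans _ _ (`|expect P g0 - emp_mean T g0|)%:E).
    by rewrite lee_fin.
  apply: ereal_sup_ubound; exists g0 => //=; split; first by exists fP.
  by rewrite expectG// subrr ltW.
(* The value [+oo] would contradict the condition on [eps], and [-oo] contradicts [mod0]. *)
have [omega modE] : exists omega : R, modulus P Q G eps = omega%:E.
  move: hyp mod0; case: (modulus P Q G eps) => [r _ _|+ _|//]; first by exists r.
  by rewrite gt0_muley ?lte_fin// addye// leye_eq.
rewrite modE -EFinM -EFinD lee_fin in hyp.
(* If no function of [G] has mean exactly [eps], then by [badH] the bad event is empty. *)
have [[h Hh]|H0] := pselect (H !=set0); last first.
  have := @outer_prob_ge R d Z n Q _ set0 (expR (- x)) measurable0; apply.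
    by move=> T /badH[g Hg _]; apply: H0; exists g.
  by rewrite measure0 lee_fin expR_ge0.
have [u [Hu udense]] := sup_separable_subset_seq sepG (fun g (Hg : H g) => proj1 Hg)
  (ex_intro _ h Hh).
set K := b * eps `^ beta + B in hyp.
pose V := K `^ nu * (w * eps `^ theta + W).
have uP k : measurable_fun setT (u k) /\ ((forall z, `|u k z| <= K) /\
    expect P (fun z => u k z ^+ 2) <= V).
  have [[f Ff fu] Eu] := Hu k; split; first by rewrite -fu; exact: mG.
  by have := GP (u k) (Hu k).1; rewrite Eu.
have epsK : eps <= K.
  apply: (@eps_le_bound R d Z P u K eps) => k.
  - exact: (uP k).1.
  - exact: (uP k).2.1.
  - exact: (Hu k).2.
have K0 : 0 < K by exact: lt_le_trans epsK.
have V0 : 0 <= V by rewrite mulr_ge0 ?powR_ge0// addr_ge0// mulr_ge0// powR_ge0.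
(* Here [y = exp (- x')] for [x' = - ln y]; the two bounds on [y] mean [0 < x' < x], the strict
   slack required by [exists_delta]. *)
have key y : expR (- x) < y < 1 -> ((1 - y)%:E <=
    outer_prob Q [set T | (risk P C (fT n T) < risk P C fP + eps%:E)%E])%E.
  move=> /andP[xy y1].
  have y0 : 0 < y by exact: lt_trans (expR_gt0 _) xy.
  have x'0 : 0 < - ln y by rewrite oppr_gt0 ln_lt0// y0.
  have x'x : - ln y < x by rewrite ltrNl -ltr_expR lnK.
  have hyp' : 3 * omega + (Num.sqrt (2 * x * V / n%:R) + 2 * x * K / n%:R) <= eps.
    by rewrite /V [2 * x * (_ * _)]mulrA.
  have [delta delta0 ineq] := exists_delta n0 K0 V0 x'0 x'x hyp'.
  apply: (@outer_prob_ge R d Z n Q _ (@low_mean R d Z n u delta)).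
  - by apply: measurable_low_mean => k; exact: (uP k).1.
  (* Approximation within [delta / 2] puts the empirical mean of some [u k] at or below [delta / 2],
     strictly under [delta]. *)
  - have delta2 : 0 < delta / 2 by rewrite divr_gt0.
    move=> T /badH[g Hg Tg0]; have [k gk] := udense g Hg (delta / 2) delta2.
    exists k; apply: (@le_lt_trans _ _ (emp_mean T g + delta / 2)); last by lra.
    rewrite -(ler_pM2l n0) mulrDr -!sum_emp_mean// mulr_natl.
    rewrite -[X in _ *+ X]card_ord -sumr_const -big_split/=.
    apply: ler_sum => i _.
    by have := gk (tnth T i); rewrite distrC => /ltW/(le_trans (ler_norm _)); lra.
  rewrite -[y]lnK// -[ln y]opprK.
  apply: (@low_mean_tail R d Z P n Q u K eps V _ _ _ _ eps0 n1 PQ _ delta omega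
   (fun T => ereal_sup [set (`|expect P g - emp_mean T g|)%:E
                         | g in [set g | G g /\ (expect P g <= eps)%R]])) => //.
  - by move=> k; exact: (uP k).1.
  - by move=> k; exact: (uP k).2.1.
  - by move=> k; exact: (Hu k).2.
  - by move=> k; exact: (uP k).2.2.
  - move=> k T; apply: ereal_sup_ubound; exists (u k) => /=; last by rewrite (Hu k).2.
    by split; [exact: (Hu k).1|rewrite (Hu k).2].
  - by rewrite -modE.
apply/lee_addgt0Pr => e e0.
have ex1 : expR (- x) < 1 by rewrite expR_lt1 oppr_lt0; lra.
(* Within [e] of [expR (- x)], while the midpoint between [expR (- x)] and [1] keeps [y] below
   [1]. *)
pose y := Num.min (expR (- x) + e) ((expR (- x) + 1) / 2).
have ye : y <= expR (- x) + e by rewrite ge_min lexx.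
have yP : expR (- x) < y < 1 by rewrite lt_min gt_min; apply/andP; split; lra.
apply: (@le_trans _ _ ((1 - y)%:E + e%:E)%E); last by rewrite leeD2r// key.
by rewrite -EFinD lee_fin; lra.
Qed.
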